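(* Let $\mathcal T_h$ be a uniform conforming mesh of $\Omega$ consisting of axis-parallel rectangles $T$ all of the same size $h_x\times h_y$, and let $\epsilon$ and $\mu$ be positive constants. Then the matrices $\mathrm M_\epsilon$, $\mathrm M_\mu$ and $\mathrm C$ of the mass-lumped mixed finite element method defined in the context coincide with the matrices $\mathrm M_\epsilon^{\mathrm{Yee}}$, $\mathrm M_\mu^{\mathrm{Yee}}$ and $\mathrm C^{\mathrm{Yee}}$ of the two-dimensional finite difference approximation on staggered grids (spatial discretization of the Yee scheme) defined in the context.
   Context: Setting. $\Omega\subset\mathbb R^2$ is a bounded polygonal domain, $\operatorname{curl} v=\partial_x v_2-\partial_y v_1$ for $v=(v_1,v_2)$, and $(a,b)=\int_\Omega a\cdot b\,dx$. The mesh is $\mathcal T_h=\{T_1,\dots,T_{n_T}\}$; every $T$ is the image $F_T(\widehat T)$ of the unit square $\widehat T=[0,1]^2$ under an affine bijection $F_T(\widehat x)=a_T+B_T\widehat x$. Reference basis functions on the unit square. Edges 1: $x=1$, 2: $y=1$, 3: $x=0$, 4: $y=0$, oriented counterclockwise; $\widehat x_{\alpha,0},\widehat x_{\alpha,1}$ denote start and end point of reference edge $\alpha$: $\widehat\phi_{1,0}=\frac12(-y^2+y,\,-2xy+2x)$, $\widehat\phi_{1,1}=\frac12(y^2-y,\,2xy)$, $\widehat\phi_{2,0}=\frac12(-2xy,\,-x^2+x)$, $\widehat\phi_{2,1}=\frac12(-2y+2xy,\,x^2-x)$, $\widehat\phi_{3,0}=\frac12(y^2-y,\,2xy-2y)$,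 $\widehat\phi_{3,1}=\frac12(-y^2+y,\,2x+2y-2xy-2)$, $\widehat\phi_{4,0}=\frac12(-2x-2y+2xy+2,\,x^2-x)$, $\widehat\phi_{4,1}=\frac12(-2xy+2x,\,-x^2+x)$. Global basis functions. Let $e_1,\dots,e_{n_e}$ be the interior edges; horizontal edges are oriented in the positive $x$-direction and vertical edges in the positive $y$-direction, and $e_i$ runs from endpoint $p_{i,0}$ to endpoint $p_{i,1}$. For $\ell\in\{0,1\}$ the function $\widetilde\phi_{i+\ell n_e}$ vanishes on all elements not having $e_i$ as an edge, and on each of the two elements $T$ having $e_i$ as an edge $\widetilde\phi_{i+\ell n_e}(F_T(\widehat x))=\sigma\,B_T^{-\top}\widehat\phi_{\alpha,\gamma}(\widehat x)$, where $\alpha$ is the number of the reference edge mapped to $e_i$ by $F_T$, $\gamma\in\{0,1\}$ is such that $F_T(\widehat x_{\alpha,\gamma})=p_{i,\ell}$, and $\sigma=1$ if $\gamma=\ell$, $\sigma=-1$ otherwise. Further $\phi_i=\widetilde\phi_i+\widetilde\phi_{i+n_e}$ for $i=1,\dots,n_e$. For $j=1,\dots,n_T$, $\psi_j$ is the function with $\psi_j|_{T_k}=\delta_{jk}$. Quadrature. $(a,b)_h=\sum_T\frac{|T|}{4}\sum_{l=1}^{4}a|_T(F_T(\widehat x_l))\cdot b|_T(F_T(\widehat x_l))$, where $\widehat x_1,\dots,\widehat x_4$ are the vertices of the unit square. Finite element matrices. $(\widetilde{\mathrm M}_\epsilon)_{ij}=(\epsilon\widetilde\phi_j,\widetilde\phi_i)_h$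 for $1\le i,j\le 2n_e$; $\mathrm P\in\mathbb R^{n_e\times 2n_e}$ with $\mathrm P_{ij}=\frac12$ if $j=i$ or $j=i+n_e$ and $\mathrm P_{ij}=0$ otherwise; $\mathrm M_\epsilon$ is the inverse of $\mathrm P\,\widetilde{\mathrm M}_\epsilon^{-1}\mathrm P^\top$; $(\mathrm M_\mu)_{ij}=(\mu\psi_j,\psi_i)$; $\mathrm C_{ij}=(\operatorname{curl}\phi_j,\psi_i)$ (curl taken elementwise). Yee matrices. The two-dimensional staggered-grid scheme discretizes $\epsilon\partial_tE_x=\partial_yH_z$, $\epsilon\partial_tE_y=-\partial_xH_z$, $\mu\partial_tH_z=\partial_yE_x-\partial_xE_y$ (with vanishing tangential electric field on $\partial\Omega$) by central differences, with $E_x$ located at midpoints of horizontal edges, $E_y$ at midpoints of vertical edges, and $H_z$ at element centers. In terms of the unknowns $\mathbf e_i=|e_i|\,\cdot$(value of the tangential component of $\mathbf E$ at the midpoint of $e_i$), approximating the line integral of $\mathbf E$ along $e_i$, and $\mathbf h_j=H_z$ at the center of $T_j$, the scheme reads $\mathrm M_\epsilon^{\mathrm{Yee}}\partial_t\mathbf e=(\mathrm C^{\mathrm{Yee}})^\top\mathbf h$, $\mathrm M_\mu^{\mathrm{Yee}}\partial_t\mathbf h=-\mathrm C^{\mathrm{Yee}}\mathbf e$, where $\mathrm M_\epsilon^{\mathrm{Yee}}$ is diagonal with $i$-th entry $\epsilon\,h_y/h_x$ if $e_i$ is horizontal and $\epsilon\,h_x/h_y$ if $e_i$ is vertical; $\mathrm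 M_\mu^{\mathrm{Yee}}=\mu\,h_xh_y\,\mathrm I$; and $\mathrm C^{\mathrm{Yee}}_{ij}=+1$ if $e_j$ is the bottom or right edge of $T_i$, $-1$ if $e_j$ is the top or left edge of $T_i$, and $0$ otherwise. *)

(* Defs.v *)
(* MathComp-Analysis; the reals are an arbitrary R : realType. *)
From mathcomp Require Export all_boot all_order all_algebra.
From mathcomp Require Export all_classical all_reals all_analysis.

Set Implicit Arguments.
Unset Strict Implicit.
Unset Printing Implicit Defensive.

Import Order.TTheory GRing.Theory Num.Theory.
Import numFieldNormedType.Exports.

Local Open Scope classical_set_scope.
Local Open Scope ring_scope.

Section Plane.
Context {R : realType}.
Implicit Types (x y a b : R * R) (A : set (R * R)).

(* Points of the plane are pairs (so that the product Lebesgue measure applies),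
   values of vector fields are column vectors. *)
Definition vec x : 'cV[R]_2 := \col_i (if i == 0 then x.1 else x.2).

Definition dot (u v : 'cV[R]_2) : R := \sum_i u i 0 * v i 0.

Definition area_measure := (@lebesgue_measure R \x @lebesgue_measure R)%E.

Definition area A : R := fine (area_measure A).

Definition segment a b : set (R * R) :=
  [set x | exists t : R, 0 <= t <= 1 /\
     x = ((1 - t) * a.1 + t * b.1, (1 - t) * a.2 + t * b.2)].

Definition boundary A : set (R * R) := closure A `\` interior A.

Definition polygonal_domain A : Prop :=
  [/\ A !=set0, open A, connected A, bounded_set A &
      exists s : seq ((R * R) * (R * R)),
        (forall ab, ab \in s -> ab.1 != ab.2) /\
        boundary A = \bigcup_(ab in [set` s]) segment ab.1 ab.2].

Definition curl (v : R * R -> 'cV[R]_2) x : R :=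
  derive1 (fun s : R => v (s, x.2) 1 0) x.1
  - derive1 (fun s : R => v (x.1, s) 0 0) x.2.

Record affine_map := AffineMap { origin : R * R; linpart : 'M[R]_2 }.

Definition affine_app (F : affine_map) x : R * R :=
  ((origin F).1 + (linpart F *m vec x) 0 0,
   (origin F).2 + (linpart F *m vec x) 1 0).

(* the inverse of affine_app F when linpart F is invertible *)
Definition affine_inv (F : affine_map) y : R * R :=
  let z := invmx (linpart F) *m (vec y - vec (origin F)) in (z 0 0, z 1 0).

Definition unit_square : set (R * R) :=
  [set x | 0 <= x.1 <= 1 /\ 0 <= x.2 <= 1].

Definition rectangle c (hx hy : R) : set (R * R) :=
  [set x | c.1 <= x.1 <= c.1 + hx /\ c.2 <= x.2 <= c.2 + hy].

(* The index al : 'I_4 stands for the reference edge number al + 1, i.e.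
   0: x = 1, 1: y = 1, 2: x = 0, 3: y = 0, oriented counterclockwise;
   the boolean selects the start (false) or the end (true) of the edge. *)
Definition ref_endpoint (al : 'I_4) (ga : bool) : R * R :=
  match val al, ga with
  | 0%N, false => (1, 0) | 0%N, true => (1, 1)
  | 1%N, false => (1, 1) | 1%N, true => (0, 1)
  | 2%N, false => (0, 1) | 2%N, true => (0, 0)
  | _, false => (0, 0) | _, true => (1, 0)
  end.

Definition ref_edge (al : 'I_4) : set (R * R) :=
  segment (ref_endpoint al false) (ref_endpoint al true).

(* every vertex of the unit square is the start of exactly one reference edge *)
Definition ref_vertex (l : 'I_4) : R * R := ref_endpoint l false.

Definition ref_basis (al : 'I_4) (ga : bool) (xh : R * R) : 'cV[R]_2 :=
  let x := xh.1 in let y := xh.2 in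
  2^-1 *: vec
  match val al, ga with
  | 0%N, false => (- y ^+ 2 + y, - (2 * x * y) + 2 * x)
  | 0%N, true => (y ^+ 2 - y, 2 * x * y)
  | 1%N, false => (- (2 * x * y), - x ^+ 2 + x)
  | 1%N, true => (- (2 * y) + 2 * x * y, x ^+ 2 - x)
  | 2%N, false => (y ^+ 2 - y, 2 * x * y - 2 * y)
  | 2%N, true => (- y ^+ 2 + y, 2 * x + 2 * y - 2 * x * y - 2)
  | _, false => (- (2 * x) - 2 * y + 2 * x * y + 2, x ^+ 2 - x)
  | _, true => (- (2 * x * y) + 2 * x, - x ^+ 2 + x)
  end.

End Plane.

Section Mesh.
Context {R : realType} {nT : nat}.
Variable F : 'I_nT -> affine_map (R := R).

Definition element (k : 'I_nT) : set (R * R) := affine_app (F k) @` unit_square.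

Definition element_edge (k : 'I_nT) (e : set (R * R)) : Prop :=
  exists al : 'I_4, e = affine_app (F k) @` ref_edge al.

Definition element_vertex (k : 'I_nT) (v : R * R) : Prop :=
  exists l : 'I_4, v = affine_app (F k) (ref_vertex l).

Definition conforming_mesh (Omega : set (R * R)) : Prop :=
  [/\ forall k, linpart (F k) \in unitmx,
      closure Omega = \bigcup_k element k &
      forall j k, j != k ->
        [\/ element j `&` element k = set0,
            exists v, [/\ element_vertex j v, element_vertex k v &
                          element j `&` element k = [set v]] |
            exists e, [/\ element_edge j e, element_edge k e &
                          element j `&` element k = e]]].

Definition interior_edge (Omega : set (R * R)) (e : set (R * R)) : Prop :=
  (exists k, element_edge k e) /\ ~ (e `<=` boundary Omega).

(* A discontinuous piecewise function is represented by the family of its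
   restrictions to the elements: a k x is the value of a|_{T_k} at x in T_k
   (values outside T_k are irrelevant). *)
Definition broken (V : Type) := 'I_nT -> R * R -> V.

(* The function on the plane defined by a piecewise function, set to zero on
   the null set where the element containing the point is not unique. *)
Definition glue (a : broken R) (x : R * R) : R :=
  \sum_(k < nT) \1_(interior (element k)) x * a k x.

Definition inner (Omega : set (R * R)) (a b : broken R) : R :=
  \int[area_measure]_(x in Omega) (glue a x * glue b x).

Definition inner_h (a b : broken 'cV[R]_2) : R :=
  \sum_(k < nT) area (element k) / 4 *
    \sum_(l < 4) let z := affine_app (F k) (ref_vertex l) in
      dot (a k z) (b k z).

Definition psi (j : 'I_nT) : broken R := fun k _ => (k == j)%:R.

Definition curl_h (v : broken 'cV[R]_2) : broken R := fun k => curl (v k).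

Section Edges.
Context {ne : nat}.
(* p i false, p i true : start and end point of the edge e_i *)
Variable p : 'I_ne -> bool -> R * R.

Definition edge (i : 'I_ne) : set (R * R) := segment (p i false) (p i true).

Definition horizontal (i : 'I_ne) : bool := (p i false).2 == (p i true).2.

Definition positively_oriented (i : 'I_ne) : Prop :=
  ((p i false).2 = (p i true).2 /\ (p i false).1 < (p i true).1) \/
  ((p i false).1 = (p i true).1 /\ (p i false).2 < (p i true).2).

Definition interior_edge_enum (Omega : set (R * R)) : Prop :=
  [/\ injective edge, range edge = interior_edge Omega &
      forall i, positively_oriented i].

(* The basis function attached to the endpoint p i l of e_i.  The search finds
   the unique (al, ga) such that F_k maps the reference edge al to e_i and its
   endpoint ga to p i l, and fails exactly when e_i is not an edge of T_k. *)
Definition edge_basis (i : 'I_ne) (l : bool) : broken 'cV[R]_2 := fun k x =>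
  match [pick ag : 'I_4 * bool |
           `[< affine_app (F k) @` ref_edge ag.1 = edge i /\
               affine_app (F k) (ref_endpoint ag.1 ag.2) = p i l >]] with
  | Some (al, ga) =>
      (if ga == l then 1 else -1) *:
        ((invmx (linpart (F k)))^T *m ref_basis al ga (affine_inv (F k) x))
  | None => 0
  end.

(* The index i + l * ne is lshift ne i for l = 0 and rshift ne i for l = 1. *)
Definition phi_tilde (j : 'I_(ne + ne)) : broken 'cV[R]_2 :=
  match fintype.split j with
  | inl i => edge_basis i false
  | inr i => edge_basis i true
  end.

Definition phi (i : 'I_ne) : broken 'cV[R]_2 := fun k x =>
  phi_tilde (lshift ne i) k x + phi_tilde (rshift ne i) k x.

Definition Meps_tilde (eps : R) : 'M[R]_(ne + ne) :=
  \matrix_(i, j) inner_h (fun k x => eps *: phi_tilde j k x) (phi_tilde i).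

Definition Pmx : 'M[R]_(ne, ne + ne) :=
  \matrix_(i, j) if (j == i :> nat) || (j == i + ne :> nat)%N then 2^-1 else 0.

Definition Meps_inv (eps : R) : 'M[R]_ne :=
  Pmx *m invmx (Meps_tilde eps) *m Pmx^T.

Definition Meps (eps : R) : 'M[R]_ne := invmx (Meps_inv eps).

Definition Mmu (Omega : set (R * R)) (mu : R) : 'M[R]_nT :=
  \matrix_(i, j) inner Omega (fun k x => mu * psi j k x) (psi i).

Definition Cmx (Omega : set (R * R)) : 'M[R]_(nT, ne) :=
  \matrix_(i, j) inner Omega (curl_h (phi j)) (psi i).

Definition Meps_Yee (hx hy eps : R) : 'M[R]_ne :=
  diag_mx (\row_i if horizontal i then eps * (hy / hx) else eps * (hx / hy)).

(* c k : lower left corner of the rectangle T_k *)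
Definition C_Yee (hx hy : R) (c : 'I_nT -> R * R) : 'M[R]_(nT, ne) :=
  \matrix_(i, j)
    let ll := c i in
    let lr := ((c i).1 + hx, (c i).2) in
    let ul := ((c i).1, (c i).2 + hy) in
    let ur := ((c i).1 + hx, (c i).2 + hy) in
    if `[< edge j = segment ll lr \/ edge j = segment lr ur >] then 1
    else if `[< edge j = segment ul ur \/ edge j = segment ll ul >] then -1
    else 0.

End Edges.

Definition Mmu_Yee (hx hy mu : R) : 'M[R]_nT := (mu * (hx * hy))%:M.

End Mesh.

Arguments affine_map R : clear implicits.

(* Main.v *)
(** Each element is the image of the unit square under one of the eight
    symmetries of a rectangle, so the covariant transform sends the nodal value
    of a reference basis function to the vector dual to the mapped edge. A
    lumped basis function is therefore nonzero at exactly one vertex of each of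
    its elements, with a value orthogonal to that of the only other basis
    function living there; the lumped mass matrix is diagonal and the projection
    by P averages its two equal halves. The curl of a basis function is constant
    on an element, equal to the inverse area up to the orientation of the edge.
    That an interior edge has exactly two neighbours, one on each side, follows
    from conformity: points of Omega just beyond the edge are covered by an
    element which must share the whole edge. The boundary of Omega is a finite
    union of segments, hence negligible in the integrals over Omega. *)
Require Import Defs.
From mathcomp Require Import ring lra measurable_realfun.

Set Implicit Arguments.
Unset Strict Implicit.
Unset Printing Implicit Defensive.

Import Order.TTheory GRing.Theory Num.Theory.
Import numFieldNormedType.Exports.

Local Open Scope classical_set_scope.
Local Open Scope ring_scope.

(** * Affine bijections of the unit square onto a rectangle, and its sides *)

Section Rectangles.
Context {R : realType}.
Implicit Types (c x y z a b : R * R) (hx hy : R) (v f l s : bool).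

Definition flip (m : bool) (t : R) : R := if m then 1 - t else t.

(* The affine bijections of the unit square onto a rectangle: [s] exchanges the
   coordinates, [m1] and [m2] reverse the first and the second one. *)
Definition frame c hx hy s (m1 m2 : bool) x : R * R :=
  (c.1 + hx * flip m1 (if s then x.2 else x.1),
   c.2 + hy * flip m2 (if s then x.1 else x.2)).

Lemma sum_ord2 (V : nmodType) (g : 'I_2 -> V) : \sum_i g i = g 0 + g 1.
Proof.
by rewrite !big_ord_recl big_ord0 addr0; congr (_ + g _); apply/val_inj.
Qed.

Lemma affine_appE (G : affine_map R) x : affine_app G x =
  ((origin G).1 + (linpart G 0 0 * x.1 + linpart G 0 1 * x.2),
   (origin G).2 + (linpart G 1 0 * x.1 + linpart G 1 1 * x.2)).
Proof.
by rewrite /affine_app !mxE !sum_ord2 !mxE.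
Qed.

(* A coordinate of [affine_app G] attains its minimum on a whole side of the
   rectangle, so it depends on one variable only. *)
Lemma affine_coordinate (o p q lo h x0 y0 x1 y1 x2 y2 : R) :
  0 < h ->
  (forall x y : R, 0 <= x <= 1 -> 0 <= y <= 1 ->
     lo <= o + (p * x + q * y) <= lo + h) ->
  0 <= x0 <= 1 -> 0 <= y0 <= 1 -> 0 <= x1 <= 1 -> 0 <= y1 <= 1 ->
  0 <= x2 <= 1 -> 0 <= y2 <= 1 ->
  (x0, y0) <> (x1, y1) ->
  o + (p * x0 + q * y0) = lo -> o + (p * x1 + q * y1) = lo ->
  o + (p * x2 + q * y2) = lo + h ->
  exists s m, forall x y : R,
    o + (p * x + q * y) = lo + h * flip m (if s then y else x).
Proof.
move=> h0 H hx0 hy0 hx1 hy1 hx2 hy2 ne e0 e1 e2.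
have u0 : 0 <= (0 : R) <= 1 by lra.
have u1 : 0 <= (1 : R) <= 1 by lra.
have H00 := H 0 0 u0 u0; have H01 := H 0 1 u0 u1.
have H10 := H 1 0 u1 u0; have H11 := H 1 1 u1 u1.
(* With both coefficients nonzero the signs would determine a single minimizing corner of the
   square, whereas the minimum is attained at two distinct points. *)
have pq : p = 0 \/ q = 0.
  have [->|p0] := eqVneq p 0; first by left.
  have [->|q0] := eqVneq q 0; first by right.
  exfalso; apply: ne.
  have ex0 := H 0 y0 u0 hy0; have ex1 := H 1 y0 u1 hy0.
  have ey0 := H x0 0 hx0 u0; have ey1 := H x0 1 hx0 u1.
  have fx0 := H 0 y1 u0 hy1; have fx1 := H 1 y1 u1 hy1.
  have fy0 := H x1 0 hx1 u0; have fy1 := H x1 1 hx1 u1.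
  have -> : x0 = x1.
    by case: (ltgtP p 0) p0 => // p0 _; nra.
  have -> // : y0 = y1.
  by case: (ltgtP q 0) q0 => // q0 _; nra.
case: pq => z; [subst p | subst q].
  have [q0|q0] := leP q 0.
    have : q = - h by nra.
    have : o = lo + h by nra.
    by move=> -> ->; exists true, true => x y /=; ring.
  have : q = h by nra.
  have : o = lo by nra.
  by move=> -> ->; exists true, false => x y /=; ring.
have [q0|q0] := leP p 0.
  have : p = - h by nra.
  have : o = lo + h by nra.
  by move=> -> ->; exists false, true => x y /=; ring.
have : p = h by nra.
have : o = lo by nra.
by move=> -> ->; exists false, false => x y /=; ring.
Qed.

(** The preimages of three corners of the rectangle suffice: each coordinate is minimal at two of
    them and maximal at the third, as [affine_coordinate] requires. *)
Lemma frame_exists (G : affine_map R) c hx hy : 0 < hx -> 0 < hy ->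
  affine_app G @` unit_square = rectangle c hx hy ->
  exists s m1 m2, affine_app G = frame c hx hy s m1 m2.
Proof.
move=> hx0 hy0 HG.
have inR (x y : R) : 0 <= x <= 1 -> 0 <= y <= 1 ->
    rectangle c hx hy (affine_app G (x, y)).
  by move=> Hx Hy; rewrite -HG; exists (x, y).
have outR z : rectangle c hx hy z -> exists x y : R,
    [/\ 0 <= x <= 1, 0 <= y <= 1 & affine_app G (x, y) = z].
  by rewrite -HG => -[[x y] [/= Hx Hy]] <-; exists x, y.
have [|xa [ya [Hxa Hya]]] := outR (c.1, c.2); first by split => /=; lra.
have [|xb [yb [Hxb Hyb]]] := outR (c.1 + hx, c.2); first by split => /=; lra.
have [|xd [yd [Hxd Hyd]]] := outR (c.1, c.2 + hy); first by split => /=; lra.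
rewrite !affine_appE /= => -[d1 d2] [b1 b2] [a1 a2].
have [s1 [m1 E1]] : exists s m, forall x y : R, (origin G).1 +
    (linpart G 0 0 * x + linpart G 0 1 * y)
    = c.1 + hx * flip m (if s then y else x).
  apply: (affine_coordinate hx0 _ Hxa Hya Hxd Hyd Hxb Hyb) => //.
    by move=> x y Hx Hy; have [] := inR _ _ Hx Hy; rewrite affine_appE.
  by case=> e1 e2; subst; lra.
have [s2 [m2 E2]] : exists s m, forall x y : R, (origin G).2 +
    (linpart G 1 0 * x + linpart G 1 1 * y)
    = c.2 + hy * flip m (if s then y else x).
  apply: (affine_coordinate hy0 _ Hxa Hya Hxb Hyb Hxd Hyd) => //.
    by move=> x y Hx Hy; have [] := inR _ _ Hx Hy; rewrite affine_appE.
  by case=> e1 e2; subst; lra.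
exists s1, m1, m2; apply/funext => -[x y].
rewrite affine_appE /= E1 E2 /frame /=; congr pair.
suff -> : s2 = ~~ s1 by case: s1 {E1}.
(* otherwise both coordinates depend on the same variable, although the lower
   two corners of the rectangle differ in the first coordinate only *)
move: (E1 xa ya) (E1 xb yb) (E1 xd yd) (E2 xa ya) (E2 xb yb) (E2 xd yd).
rewrite a1 a2 b1 b2 d1 d2 /flip.
by case: s1 {E1}; case: s2 {E2} => //; case: m1; case: m2 => *; exfalso; nra.
Qed.

(* [v] tells whether the side is vertical, [f] whether it is the top or the
   right one. *)
Definition side_start c hx hy v f : R * R :=
  (c.1 + (if v && f then hx else 0), c.2 + (if ~~ v && f then hy else 0)).

Definition side_end c hx hy v f : R * R :=
  ((side_start c hx hy v f).1 + (if v then 0 else hx),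
   (side_start c hx hy v f).2 + (if v then hy else 0)).

Definition side c hx hy v f : set (R * R) :=
  segment (side_start c hx hy v f) (side_end c hx hy v f).

Definition ordered a b : Prop := a.1 <= b.1 /\ a.2 <= b.2.

Lemma segment_start a b : segment a b a.
Proof. by exists 0; split; [lra | case: a => ? ?/=; congr pair; ring]. Qed.

Lemma segment_end a b : segment a b b.
Proof. by exists 1; split; [lra | case: b => ? ?/=; congr pair; ring]. Qed.

(** The endpoints of an ordered segment are its least and greatest points for the componentwise
    order, so the set determines them. *)
Lemma ordered_segment_inj a b a' b' : ordered a b -> ordered a' b' ->
  segment a b = segment a' b' -> a = a' /\ b = b'.
Proof.
have bnd p q z : ordered p q -> segment p q z -> ordered p z /\ ordered z q.
  move: p q => [p1 p2] [q1 q2] [/= h1 h2] [t [t01 ->]].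
  by split; split => /=; nra.
have le2 p q : ordered p q -> ordered q p -> p = q.
  move: p q => [p1 p2] [q1 q2] [/= h1 h2] [/= h3 h4].
  by congr pair; lra.
move=> ab ab' E.
have [] := bnd a b a' ab; first by rewrite E; exact: segment_start.
have [] := bnd a b b' ab; first by rewrite E; exact: segment_end.
have [] := bnd a' b' a ab'; first by rewrite -E; exact: segment_start.
have [] := bnd a' b' b ab'; first by rewrite -E; exact: segment_end.
by move=> *; split; apply: le2.
Qed.

Lemma side_ordered c hx hy v f : 0 < hx -> 0 < hy ->
  ordered (side_start c hx hy v f) (side_end c hx hy v f).
Proof. by move=> ? ?; split=> /=; case: v; lra. Qed.

Lemma sideP c hx hy v f z : 0 < hx -> 0 < hy ->
  side c hx hy v f z <->
  if v then z.1 = c.1 + (if f then hx else 0) /\ c.2 <= z.2 <= c.2 + hy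
  else z.2 = c.2 + (if f then hy else 0) /\ c.1 <= z.1 <= c.1 + hx.
Proof.
move=> hx0 hy0; rewrite /side /segment /side_end /side_start; case: v => /=.
- split=> [[t [t01 ->]] /=|[e h]]; first by split; [ring | nra].
  exists ((z.2 - c.2) / hy); split.
    by rewrite divr_ge0 ?ler_pdivrMr ?mul1r //=; lra.
  by rewrite [LHS]surjective_pairing e /=; congr pair; field; rewrite gt_eqF.
- split=> [[t [t01 ->]] /=|[e h]]; first by split; [ring | nra].
  exists ((z.1 - c.1) / hx); split.
    by rewrite divr_ge0 ?ler_pdivrMr ?mul1r //=; lra.
  by rewrite [LHS]surjective_pairing e /=; congr pair; field; rewrite gt_eqF.
Qed.

(** One set can be a side of two congruent rectangles, but then they lie on opposite sides of it;
    this is the source of all later uniqueness of neighbours. *)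
Lemma side_inj c c' hx hy v v' f f' : 0 < hx -> 0 < hy ->
  side c hx hy v f = side c' hx hy v' f' ->
  v = v' /\ (f = f' <-> c = c').
Proof.
move=> hx0 hy0 E.
have [] := ordered_segment_inj (side_ordered _ _ _ hx0 hy0)
  (side_ordered _ _ _ hx0 hy0) E.
rewrite /side_end /side_start; case: c c' {E} => [c1 c2] [d1 d2] /=.
move=> [e1 e2] [e3 e4].
have vv : v = v' by move: e3 e4; case: v v' e1 e2 => -[] //=; lra.
split=> //; subst; split=> [ff|[? ?]]; subst; first by congr pair; lra.
by move: e1 e2; case: v' e3 e4; case: f; case: f' => //=; lra.
Qed.

(** Opposite sides have no common vertex, so parallel sides of one rectangle that meet at a vertex
    are equal. *)
Lemma side_endpoint_far c hx hy v f f' l (m : bool) : 0 < hx -> 0 < hy ->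
  (if l then side_end else side_start) c hx hy v f =
  (if m then side_end else side_start) c hx hy v f' -> f = f'.
Proof.
move=> hx0 hy0 E; move: (congr1 fst E) (congr1 snd E).
rewrite /side_end /side_start.
by case: l m v f f' {E} => -[] [] [] [] //= *; exfalso; lra.
Qed.

Lemma ordered_eq_side a b c hx hy v f : 0 < hx -> 0 < hy -> ordered a b ->
  segment a b = side c hx hy v f ->
  a = side_start c hx hy v f /\ b = side_end c hx hy v f.
Proof.
by move=> ? ? ? ?; apply: ordered_segment_inj => //; exact: side_ordered.
Qed.

(** The counterclockwise numbering starts with [x = 1], [y = 1]: parity gives the direction, and the
    first two edges are the right and the top one. *)
Definition ref_vert (al : 'I_4) : bool := ~~ odd al.
Definition ref_far (al : 'I_4) : bool := (al < 2)%N.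

Lemma ref_side_inj (al be : 'I_4) :
  ref_vert al = ref_vert be -> ref_far al = ref_far be -> al = be.
Proof.
rewrite /ref_vert /ref_far => h1 h2; apply/val_inj; move: h1 h2.
by case: al => -[|[|[|[|?]]]] //= _; case: be => -[|[|[|[|?]]]].
Qed.

Lemma ref_side_surj v f : exists al, ref_vert al = v /\ ref_far al = f.
Proof.
case: v; case: f.
- by exists (@Ordinal 4 0 isT).
- by exists (@Ordinal 4 2 isT).
- by exists (@Ordinal 4 1 isT).
- by exists (@Ordinal 4 3 isT).
Qed.

Definition frame_vert s (al : 'I_4) : bool := ref_vert al (+) s.
Definition frame_far s (m1 m2 : bool) (al : 'I_4) : bool :=
  ref_far al (+) (if frame_vert s al then m1 else m2).

(* [s (+) m1 (+) m2] tells whether the frame reverses the orientation; the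
   counterclockwise orientation of a side agrees with the coordinate direction
   on the bottom and right sides. *)
Definition frame_rev s (m1 m2 : bool) (al : 'I_4) : bool :=
  s (+) m1 (+) m2 (+) frame_vert s al (+) frame_far s m1 m2 al.

Lemma frame_endpoint c hx hy s m1 m2 al ga :
  frame c hx hy s m1 m2 (ref_endpoint al ga) =
  (if ga (+) frame_rev s m1 m2 al then side_end else side_start)
    c hx hy (frame_vert s al) (frame_far s m1 m2 al).
Proof.
rewrite /frame_rev /frame_far /frame_vert /ref_vert /ref_far.
rewrite /side_end /side_start /frame /flip.
case: al => -[|[|[|[|?]]]] //= ?; rewrite /ref_endpoint /=;
  by case: ga; case: s; case: m1; case: m2; rewrite /=; congr pair; ring.
Qed.

Lemma frame_segment c hx hy s m1 m2 a b :
  frame c hx hy s m1 m2 @` segment a b =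
  segment (frame c hx hy s m1 m2 a) (frame c hx hy s m1 m2 b).
Proof.
apply/seteqP; split=> [_ [_ [t [t01 ->]] <-]|_ [t [t01 ->]]].
  exists t; split=> //; rewrite /frame /flip /=.
  by case: s; case: m1; case: m2; congr pair; ring.
eexists; first by exists t; split; [exact: t01 | reflexivity].
rewrite /frame /flip /=.
by case: s; case: m1; case: m2; congr pair; ring.
Qed.

Lemma segmentC a b : segment a b = segment b a.
Proof.
by apply/seteqP; split=> _ [t [t01 ->]]; exists (1 - t); split;
  [lra | congr pair; ring | lra | congr pair; ring].
Qed.

Lemma frame_edge c hx hy s m1 m2 al :
  frame c hx hy s m1 m2 @` ref_edge al =
  side c hx hy (frame_vert s al) (frame_far s m1 m2 al).
Proof.
rewrite frame_segment !frame_endpoint /=.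
by case: frame_rev => //=; rewrite segmentC.
Qed.

Lemma frame_side_inj s m1 m2 al be :
  frame_vert s al = frame_vert s be ->
  frame_far s m1 m2 al = frame_far s m1 m2 be -> al = be.
Proof.
rewrite /frame_far => E; rewrite E => /addIb ?.
by apply: ref_side_inj => //; move: E => /addIb.
Qed.

Lemma frame_side_surj s m1 m2 v f :
  exists al, frame_vert s al = v /\ frame_far s m1 m2 al = f.
Proof.
have [al [h1 h2]] := ref_side_surj (v (+) s) (f (+) (if v then m1 else m2)).
exists al; have E : frame_vert s al = v by rewrite /frame_vert h1 addbK.
by rewrite /frame_far E h2 addbK.
Qed.

End Rectangles.

(** * Topology and area of rectangles; segments are null sets *)

Section PlaneMeasure.
Context {R : realType}.
Implicit Types (c z a b : R * R) (hx hy : R) (A : set (R * R)).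

Lemma nbhs_boxP z A : nbhs z A <-> exists2 e : R, 0 < e &
  forall x y : R, `|x - z.1| < e -> `|y - z.2| < e -> A (x, y).
Proof.
split=> [/nbhs_ballP [e /= e0 H]|[e e0 H]].
  exists e => // x y hx hy; apply: H; split; rewrite /= /ball /=.
    by rewrite distrC.
  by rewrite distrC.
apply/nbhs_ballP; exists e => //= -[x y] []; rewrite /ball /= => h1 h2.
by apply: H; rewrite distrC.
Qed.

Lemma interior_rectangle c hx hy :
  interior (rectangle c hx hy) =
  `]c.1, c.1 + hx[%classic `*` `]c.2, c.2 + hy[%classic.
Proof.
apply/seteqP; split=> [z /nbhs_boxP [e e0 H]|z].
  (* Steps of length [e / 2] both ways along the diagonal yield all four strict inequalities. *)
  have h t : `|t| < e -> rectangle c hx hy (z.1 + t, z.2 + t).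
    by move=> te; apply: H; rewrite addrAC subrr add0r.
  have [|h1 h2] := h (e / 2); first by rewrite gtr0_norm; lra.
  have [|h3 h4] := h (- (e / 2)); first by rewrite normrN gtr0_norm; lra.
  by split; rewrite /= in_itv /=; move: h1 h2 h3 h4 => /=; lra.
move=> [/=]; rewrite !in_itv /= => h1 h2.
apply/nbhs_boxP.
exists (Order.min (Order.min (z.1 - c.1) (c.1 + hx - z.1))
                  (Order.min (z.2 - c.2) (c.2 + hy - z.2))).
  by rewrite !lt_min; lra.
move=> x y; rewrite !lt_min !ltr_norml => k1 k2.
by split => /=; lra.
Qed.

Lemma near_not_rectangle c hx hy z :
  ~ rectangle c hx hy z -> nbhs z (~` rectangle c hx hy).
Proof.
move=> nz; suff [e e0 He] : exists2 e : R, 0 < e &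
    z.1 + e <= c.1 \/ c.1 + hx <= z.1 - e \/
    z.2 + e <= c.2 \/ c.2 + hy <= z.2 - e.
  apply/nbhs_boxP; exists e => // x y; rewrite !ltr_norml => h1 h2 [/=].
  by lra.
have [h|h] := ltP z.1 c.1; first by exists (c.1 - z.1); lra.
have [h'|h'] := ltP (c.1 + hx) z.1; first by exists (z.1 - (c.1 + hx)); lra.
have [k|k] := ltP z.2 c.2; first by exists (c.2 - z.2); lra.
have [k'|k'] := ltP (c.2 + hy) z.2; first by exists (z.2 - (c.2 + hy)); lra.
by exfalso; apply: nz; split; lra.
Qed.

Lemma rectangleE c hx hy : rectangle c hx hy =
  `[c.1, c.1 + hx]%classic `*` `[c.2, c.2 + hy]%classic.
Proof. by apply/seteqP; split=> z []; rewrite /= !in_itv. Qed.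

Lemma area_measureX (i j : interval R) :
  area_measure ([set` i] `*` [set` j]) =
  (lebesgue_measure [set` i] * lebesgue_measure [set` j])%E.
Proof. by rewrite /area_measure product_measure1E. Qed.

Lemma area_rectangle c hx hy : 0 < hx -> 0 < hy ->
  area (rectangle c hx hy) = hx * hy.
Proof.
move=> hx0 hy0; rewrite /area rectangleE area_measureX !lebesgue_measure_itv /=.
rewrite !lte_fin !ltrDl hx0 hy0 -!EFinD -EFinM /=.
by congr (_ * _); ring.
Qed.

Lemma area_measure_interior_rectangle c hx hy : 0 < hx -> 0 < hy ->
  area_measure (interior (rectangle c hx hy)) = (hx * hy)%:E.
Proof.
move=> hx0 hy0; rewrite interior_rectangle area_measureX !lebesgue_measure_itv /=.
rewrite !lte_fin !ltrDl hx0 hy0 -!EFinD -EFinM /=.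
by congr (_ * _)%:E; ring.
Qed.

Lemma measurable_interior_rectangle c hx hy :
  measurable (interior (rectangle c hx hy)).
Proof. by rewrite interior_rectangle; exact: measurableX. Qed.

Lemma measurable_line (p q r : R) :
  measurable [set z : R * R | p * z.1 + q * z.2 = r].
Proof.
rewrite [X in measurable X](_ : _ =
  (fun z : R * R => p * z.1 + q * z.2) @^-1` [set r]); last by [].
rewrite -[X in measurable X]setTI.
suff : measurable_fun setT (fun z : R * R => p * z.1 + q * z.2).
  by move=> H; apply: H; [exact: measurableT | exact: measurable_set1].
by apply: measurable_funD; apply: measurable_funM.
Qed.

(** A vertical line is a product with a null factor; on any other line every vertical section is a
    single point, and the integral of the section measures vanishes. *)
Lemma area_measure_line (p q r : R) : (p, q) <> (0, 0) ->
  area_measure [set z : R * R | p * z.1 + q * z.2 = r] = 0%E.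
Proof.
move=> pq; have mL := measurable_line p q r.
have [q0|q0] := eqVneq q 0.
  have p0 : p != 0 by apply/eqP => p0; apply: pq; rewrite p0 q0.
  rewrite [X in area_measure X](_ : _ = [set r / p] `*` setT).
    rewrite /area_measure product_measure1E //=.
    by rewrite [X in (X * _)%E]lebesgue_measure_set1 mul0e.
  apply/seteqP; split=> z /=; rewrite q0 mul0r addr0.
    by move=> <-; split=> //; rewrite mulrC mulKf.
  by move=> [-> _]; rewrite mulrC divfK.
rewrite /area_measure /product_measure1.
apply: integral0_eq => x _ /=.
rewrite [X in lebesgue_measure X](_ : _ = [set (r - p * x) / q]).
  exact: lebesgue_measure_set1.
apply/seteqP; split=> y; rewrite /xsection /= inE /=.
  by move=> <-; rewrite addrAC subrr add0r mulrC mulKf.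
by move=> ->; field.
Qed.

(** Writing a segment as a line cut by its bounding box gives both its measurability and its
    vanishing area. *)
Lemma segmentE a b : segment a b =
  [set z | (a.2 - b.2) * z.1 + (b.1 - a.1) * z.2
           = (a.2 - b.2) * a.1 + (b.1 - a.1) * a.2] `&`
  rectangle (Order.min a.1 b.1, Order.min a.2 b.2)
            (`|b.1 - a.1|) (`|b.2 - a.2|).
Proof.
have cvx (u w t : R) : 0 <= t <= 1 ->
    Order.min u w <= (1 - t) * u + t * w <= Order.min u w + `|w - u|.
  move=> t01; have [uw|wu] := leP u w.
    have -> : `|w - u| = w - u by apply: ger0_norm; lra.
    by nra.
  have -> : `|w - u| = - (w - u) by apply: ltr0_norm; lra.
  by nra.
have par (u w z : R) : u != w -> Order.min u w <= z <= Order.min u w + `|w - u| ->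
    0 <= (z - u) / (w - u) <= 1.
  case: (ltgtP u w) => // uw _.
    have -> : `|w - u| = w - u by apply: ger0_norm; lra.
    move=> h.
    by rewrite divr_ge0 ?ler_pdivrMr ?mul1r /=; lra.
  have -> : `|w - u| = - (w - u) by apply: ltr0_norm; lra.
  move=> h.
  rewrite -[_ / _]mulrNN -invrN.
  by rewrite divr_ge0 ?ler_pdivrMr ?mul1r /=; lra.
apply/seteqP; split=> [_ [t [t01 ->]]|z [/= L [/= h1 h2]]].
  by split=> /=; [ring | split=> /=; exact: cvx].
have [E1|E1] := eqVneq a.1 b.1; last first.
  exists ((z.1 - a.1) / (b.1 - a.1)); split; first exact: par.
  have n1 : b.1 - a.1 != 0 by rewrite subr_eq0 eq_sym.
  rewrite [LHS]surjective_pairing; congr pair; first by field.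
  apply: (mulfI n1); transitivity ((a.2 - b.2) * a.1 + (b.1 - a.1) * a.2 -
    (a.2 - b.2) * z.1); first by rewrite -L; ring.
  by field.
have [E2|E2] := eqVneq a.2 b.2.
  rewrite -E1 minxx subrr normr0 in h1; rewrite -E2 minxx subrr normr0 in h2.
  exists 0; split; first by lra.
  by rewrite [LHS]surjective_pairing; congr pair; lra.
exists ((z.2 - a.2) / (b.2 - a.2)); split; first exact: par.
have n1 : b.2 - a.2 != 0 by rewrite subr_eq0 eq_sym.
rewrite [LHS]surjective_pairing; congr pair; last by field.
rewrite -E1 minxx subrr normr0 in h1.
rewrite -E1; have -> : z.1 = a.1 by lra.
by field.
Qed.

Lemma measurable_segment a b : measurable (segment a b).
Proof.
rewrite segmentE; apply: measurableI; first exact: measurable_line.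
by rewrite rectangleE; exact: measurableX.
Qed.

Lemma area_measure_segment a b : a != b -> area_measure (segment a b) = 0%E.
Proof.
move=> ab; apply: (@subset_measure0 _ _ _ area_measure _
  [set z | (a.2 - b.2) * z.1 + (b.1 - a.1) * z.2
           = (a.2 - b.2) * a.1 + (b.1 - a.1) * a.2]).
- exact: measurable_segment.
- exact: measurable_line.
- by rewrite segmentE; exact: subIsetl.
apply: area_measure_line => -[e1 e2]; case/eqP: ab.
by case: a b e1 e2 => [? ?] [? ?] /= ? ?; congr pair; lra.
Qed.

Lemma bigcup_segments_null (s : seq ((R * R) * (R * R))) :
  (forall ab, ab \in s -> ab.1 != ab.2) ->
  measurable (\bigcup_(ab in [set` s]) segment ab.1 ab.2) /\
  area_measure (\bigcup_(ab in [set` s]) segment ab.1 ab.2) = 0%E.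
Proof.
elim: s => [|ab s IH] H.
  by rewrite set_nil bigcup_set0; split; [exact: measurable0 | exact: measure0].
have [|ms s0] := IH; first by move=> x xs; apply: H; rewrite inE xs orbT.
have -> : [set` ab :: s] = ab |` [set` s].
  apply/seteqP; split=> x /=; rewrite inE.
    by case/orP => [/eqP ->|]; [left | right].
  by case=> [->|->]; rewrite ?eqxx ?orbT.
rewrite bigcup_setU1; have mab := measurable_segment ab.1 ab.2; split.
  exact: measurableU.
transitivity (area_measure (segment ab.1 ab.2)); first exact: measureU0.
by apply: area_measure_segment; apply: H; rewrite inE eqxx.
Qed.

(** * Integrals over [Omega] against the indicator of an element *)

Section Inner.
Context {nT : nat} (F : 'I_nT -> affine_map R) (Omega : set (R * R)).
Context (c : 'I_nT -> R * R) (hx hy : R).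
Hypotheses (hx0 : 0 < hx) (hy0 : 0 < hy).
Hypothesis F_rect : forall k, element F k = rectangle (c k) hx hy.
Hypothesis F_disj : forall j k, j != k ->
  interior (element F j) `&` interior (element F k) = set0.

Lemma glueE (a : broken R) k z : interior (element F k) z -> glue F a z = a k z.
Proof.
move=> kz; rewrite /glue (bigD1 k) //= big1 ?addr0 => [|j jk].
  by rewrite indicE mem_set // mul1r.
rewrite indicE memNset ?mul0r // => jz.
by have /seteqP [/(_ z)] := F_disj jk; case.
Qed.

Lemma glue_psi k z : glue F (psi k) z = \1_(interior (element F k)) z.
Proof.
rewrite /glue /psi (bigD1 k) //= big1 ?addr0 ?eqxx ?mulr1 // => j /negPf ->.
by rewrite mulr0.
Qed.

(* The interior of an element meets [Omega] up to the null set
   [boundary Omega]. *)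
Lemma inner_psi (a : broken R) i (val : R) :
  polygonal_domain Omega -> element F i `<=` closure Omega ->
  (forall z, interior (element F i) z -> a i z = val) ->
  inner F Omega a (psi i) = val * (hx * hy).
Proof.
move=> [_ oO _ _ [s [s_neq bO]]] iO ai.
have [mB B0] := bigcup_segments_null s_neq.
pose I : set (R * R) := interior (element F i).
have mI : measurable I by rewrite /I F_rect; exact: measurable_interior_rectangle.
(* [Omega] is open, so a point of its closure off the boundary belongs to it. *)
have EI : I `&` Omega = I `\` boundary Omega.
  rewrite /boundary (interior_id _).1 //; apply/seteqP; split=> z [Iz Oz].
    by split=> // -[].
  split=> //; apply: contrapT => nOz; apply: Oz; split=> //.
  by apply: iO; exact: interior_subset.
rewrite /inner /Rintegral integral_mkcond.
rewrite (_ : _ \_ Omega = (fun=> val%:E) \_ (I `&` Omega)); last first.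
  apply/funext => z; rewrite !patchE glue_psi indicE.
  rewrite in_setI; case: (boolP (z \in Omega)) => Oz; rewrite -/I ?andbF ?andbT //.
  case: (boolP (z \in I)) => Iz; last by rewrite mulr0.
  by rewrite mulr1 (glueE _ (set_mem Iz)) ai //; exact: set_mem.
rewrite -integral_mkcond EI bO integral_cst; last exact: measurableD.
set B := \bigcup_(ab in _) _ in mB B0 *.
have I_area : area_measure I = (hx * hy)%:E.
  by rewrite /I F_rect area_measure_interior_rectangle.
have mIB : measurable (I `&` B) by exact: measurableI.
have IB0 : area_measure (I `&` B) = 0%E.
  exact: (@subset_measure0 _ _ _ area_measure _ B).
suff E : area_measure (I `\` B) = (hx * hy)%:E.
  transitivity (fine (val%:E * area_measure (I `\` B))%E); first by [].
  by rewrite E.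
transitivity (area_measure I - area_measure (I `&` B))%E.
  apply: measureD => //.
  by apply: (@le_lt_trans _ _ (area_measure I)); rewrite // I_area ltry.
by rewrite I_area IB0 sube0.
Qed.

End Inner.
End PlaneMeasure.

(** * Covariant transform, nodal values and curl of the reference basis *)

Section LocalBasis.
Context {R : realType}.
Implicit Types (c x y z a b : R * R) (hx hy : R) (v f s l : bool).

Definition sg (m : bool) : R := if m then -1 else 1.

Lemma frame_linpart (G : affine_map R) c hx hy s m1 m2 :
  affine_app G = frame c hx hy s m1 m2 ->
  [/\ linpart G 0 0 = (if s then 0 else hx * sg m1),
      linpart G 0 1 = (if s then hx * sg m1 else 0),
      linpart G 1 0 = (if s then hy * sg m2 else 0) &
      linpart G 1 1 = (if s then 0 else hy * sg m2)].
Proof.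
move=> E; have e z := congr1 (@^~ z) E.
move: (e (0, 0)) (e (1, 0)) (e (0, 1)); rewrite !affine_appE /frame /flip /sg /=.
move=> [a1 a2] [b1 b2] [d1 d2].
by split; move: a1 a2 b1 b2 d1 d2; case: s {E e}; case: m1; case: m2 => *; lra.
Qed.

Lemma det_mx22 (A : 'M[R]_2) : \det A = A 0 0 * A 1 1 - A 0 1 * A 1 0.
Proof.
rewrite (expand_det_row _ 0) sum_ord2 /cofactor !det_mx11 !mxE /=.
rewrite (_ : lift 0 0 = 1); last exact/val_inj.
rewrite (_ : lift 1 0 = 0); last exact/val_inj.
by rewrite expr0 expr1; ring.
Qed.

Lemma frame_det (G : affine_map R) c hx hy s m1 m2 :
  affine_app G = frame c hx hy s m1 m2 ->
  \det (linpart G) = hx * hy * sg (s (+) m1 (+) m2).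
Proof.
move=> /frame_linpart [e00 e01 e10 e11]; rewrite det_mx22 e00 e01 e10 e11 /sg.
by case: s {e00 e01 e10 e11}; case: m1; case: m2 => /=; ring.
Qed.

(* The vector dual to a side: its component along the side is the inverse of the
   length, so that its line integral along the side is 1. *)
Definition side_dual hx hy v : 'cV[R]_2 :=
  vec (if v then (0, hy^-1) else (hx^-1, 0)).

Definition ref_tangent (al : 'I_4) : 'cV[R]_2 :=
  vec (ref_endpoint al true) - vec (ref_endpoint al false).

Lemma cV2P (u w : 'cV[R]_2) : u 0 0 = w 0 0 -> u 1 0 = w 1 0 -> u = w.
Proof.
move=> e0 e1; apply/colP => i; have [->//|] := eqVneq i 0.
case: i => -[|[|?]] //= hi _; rewrite -[RHS]/(w _ 0).
by have -> : Ordinal hi = 1 by apply/val_inj.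
Qed.

(** The linear part maps the reference tangent to the side vector up to sign, which pairs to 1 with
    the dual vector, and maps the other direction to a perpendicular one. The inverse transpose thus
    sends tangents to signed dual vectors. *)
Lemma frame_dual (G : affine_map R) c hx hy s m1 m2 al : hx != 0 -> hy != 0 ->
  affine_app G = frame c hx hy s m1 m2 ->
  (linpart G)^T *m side_dual hx hy (frame_vert s al) =
  sg (frame_rev s m1 m2 al) *: ref_tangent al.
Proof.
move=> hx0 hy0 /frame_linpart [e00 e01 e10 e11].
rewrite /side_dual /ref_tangent /frame_rev /frame_far /frame_vert.
rewrite /ref_vert /ref_far /ref_endpoint /sg.
apply: cV2P; rewrite !mxE sum_ord2 !mxE /= ?e00 ?e01 ?e10 ?e11 /sg {e00 e01 e10 e11};
  case: al => -[|[|[|[|?]]]] //= _; case: s; case: m1; case: m2 => /=;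
  field; by rewrite ?hx0 ?hy0.
Qed.

Lemma affine_invK (G : affine_map R) : linpart G \in unitmx ->
  cancel (affine_app G) (affine_inv G).
Proof.
move=> uG x; rewrite /affine_inv.
have -> : vec (affine_app G x) - vec (origin G) = linpart G *m vec x.
  by apply: cV2P; rewrite !mxE /= addrAC subrr add0r !mxE.
by rewrite mulKmx // !mxE /=; case: x.
Qed.

(** Vertex [l] starts edge [l], so an edge ends at the vertex of its cyclic successor. *)
Definition ref_endpoint_index (al : 'I_4) (ga : bool) : 'I_4 :=
  if ga then ordS al else al.

Lemma ref_endpoint_vertex (al : 'I_4) (ga : bool) :
  ref_endpoint al ga = ref_vertex (ref_endpoint_index al ga) :> R * R.
Proof. by case: al => -[|[|[|[|?]]]] //= ?; case: ga. Qed.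

(** This nodal property is why quadrature at the vertices lumps the mass matrix. *)
Lemma ref_basis_vertex (al : 'I_4) (ga : bool) (r : 'I_4) :
  ref_basis al ga (ref_vertex r) =
  (r == ref_endpoint_index al ga)%:R *: ref_tangent al.
Proof.
rewrite /ref_tangent /ref_basis /ref_vertex /ref_endpoint.
apply: cV2P; rewrite !mxE /= -val_eqE;
  case: al => -[|[|[|[|?]]]] //= ?; case: ga;
  case: r => -[|[|[|[|?]]]] //= ?; by field.
Qed.

Lemma derive1_affine (g : R -> R) (A t : R) :
  (forall u, g u = A * u + g 0) -> derive1 g t = A.
Proof.
move=> H; have -> : g = (fun u => A * u + g 0) by apply/funext.
rewrite derive1E.
have E : is_derive t 1 (fun u : R => A * u + g 0) (A * 1 + 0).
  by apply: is_deriveD; apply: is_deriveM.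
by rewrite (@derive_val _ _ _ _ _ _ _ E) mulr1 addr0.
Qed.

(** The quadratic terms cancel, leaving the lowest-order edge element function, whose curl is 1. *)
Lemma ref_basis_sum (al : 'I_4) z :
  ref_basis al false z + ref_basis al true z =
  vec (if ref_vert al then (0, z.1 - (~~ ref_far al)%:R)
       else ((~~ ref_far al)%:R - z.2, 0)).
Proof.
rewrite /ref_basis /ref_vert /ref_far.
by apply: cV2P; rewrite !mxE /=; case: al => -[|[|[|[|?]]]] //= ?; field.
Qed.

Lemma affine_invE (G : affine_map R) y : let W := invmx (linpart G) in
  affine_inv G y =
  (W 0 0 * (y.1 - (origin G).1) + W 0 1 * (y.2 - (origin G).2),
   W 1 0 * (y.1 - (origin G).1) + W 1 1 * (y.2 - (origin G).2)).
Proof. by rewrite /affine_inv !mxE !sum_ord2 !mxE. Qed.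

(** The covariant transform multiplies the curl, here 1, by the determinant of the inverse linear
    part. Both partial derivatives are read off from affine functions, and their difference is that
    determinant. *)
Lemma curl_ref_basis (G : affine_map R) al (k : R) x :
  curl (fun y => k *: ((invmx (linpart G))^T *m
    (ref_basis al false (affine_inv G y) + ref_basis al true (affine_inv G y)))) x
  = k * \det (invmx (linpart G)).
Proof.
rewrite /curl det_mx22.
rewrite (@derive1_affine _
  (if ref_vert al then k * invmx (linpart G) 0 0 * invmx (linpart G) 1 1
   else - k * invmx (linpart G) 0 1 * invmx (linpart G) 1 0)).
  rewrite (@derive1_affine _
    (if ref_vert al then k * invmx (linpart G) 0 1 * invmx (linpart G) 1 0
     else - k * invmx (linpart G) 0 0 * invmx (linpart G) 1 1)).
    by case: ref_vert; ring.
  move=> u; rewrite !ref_basis_sum !affine_invE !mxE !sum_ord2 !mxE /=.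
  by move: (invmx _) => W; case: ref_vert => /=; ring.
move=> u; rewrite !ref_basis_sum !affine_invE !mxE !sum_ord2 !mxE /=.
by move: (invmx _) => W; case: ref_vert => /=; ring.
Qed.

End LocalBasis.

(** * Points in the relative interior of a side *)

Section Sides.
Context {R : realType}.
Implicit Types (c x y z a b : R * R) (v f s l : bool).

Definition corner c (hx hy : R) z : Prop :=
  (z.1 = c.1 \/ z.1 = c.1 + hx) /\ (z.2 = c.2 \/ z.2 = c.2 + hy).

Lemma frame_corner c (hx hy : R) s m1 m2 r :
  corner c hx hy (frame c hx hy s m1 m2 (ref_vertex r)).
Proof.
rewrite /frame /corner /ref_vertex /ref_endpoint /flip.
by case: r => -[|[|[|[|?]]]] //= ?; case: s; case: m1; case: m2 => /=; lra.
Qed.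

Lemma close_interior_point (a h t e : R) : 0 < h -> 0 < e -> a <= t <= a + h ->
  exists2 t', a < t' < a + h & `|t' - t| < e.
Proof.
(* The point is pulled towards the midpoint by the fraction [e / (e + h)], which lies strictly
   between 0 and 1 and keeps the displacement below [e]. *)
move=> h0 e0 th; exists (t + (a + h / 2 - t) * (e / (e + h))).
  have r0 : 0 < e / (e + h) by rewrite divr_gt0; lra.
  have r1 : e / (e + h) < 1 by rewrite ltr_pdivrMr; lra.
  by nra.
rewrite addrAC subrr add0r ltr_norml.
have r0 : 0 < e / (e + h) by rewrite divr_gt0; lra.
have : e / (e + h) * h < e by rewrite mulrAC ltr_pdivrMr; nra.
by nra.
Qed.

(* Moving a point slightly into the relative interior of its side makes that
   side the only part of the boundary of the rectangle containing it. *)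
Lemma side_relative_interior c (hx hy : R) v f y (A : set (R * R)) :
  0 < hx -> 0 < hy -> side c hx hy v f y -> nbhs y A ->
  exists z, [/\ nbhs z A, rectangle c hx hy z, ~ corner c hx hy z,
    forall v' f', side c hx hy v' f' z -> v' = v /\ f' = f &
    forall U, nbhs z U -> exists2 w, U w & ~ rectangle c hx hy w].
Proof.
move=> hx0 hy0 /(sideP _ _ _ _ hx0 hy0) yS /nbhs_boxP [e e0 eA].
(* Staying within [e / 2] of [y] leaves a box of radius [e / 2] around [z] inside [A]. *)
suff [z [z1 z2 zS]] : exists z, [/\ `|z.1 - y.1| < e / 2, `|z.2 - y.2| < e / 2 &
    if v then z.1 = c.1 + (if f then hx else 0) /\ c.2 < z.2 < c.2 + hy
    else z.2 = c.2 + (if f then hy else 0) /\ c.1 < z.1 < c.1 + hx].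
  exists z; split.
  - apply/nbhs_boxP; exists (e / 2); first by lra.
    move=> x1 x2; move: z1 z2; rewrite !ltr_norml => z1 z2 h1 h2.
    by apply: eA; rewrite ltr_norml; lra.
  - by split; case: v {yS} zS; case: f; lra.
  - by rewrite /corner; case: v {yS} zS; case: f; lra.
  - move=> v' f' /(sideP _ _ _ _ hx0 hy0).
    by case: v {yS} zS; case: f; case: v'; case: f' => //; lra.
  (* The point outside is reached by crossing the side perpendicularly, outwards, by half the radius
     of a box in [U]. *)
  - move=> U /nbhs_boxP [d d0 dU].
    have d2 : `|if f then d / 2 else - (d / 2)| < d.
      by rewrite ltr_norml; case: (f); lra.
    have dn0 : `|0 : R| < d by rewrite normr0.
    case: v {yS} zS => -[zf zb].
      exists (z.1 + (if f then d / 2 else - (d / 2)), z.2).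
        by apply: dU; rewrite ?subrr // addrAC subrr add0r.
      by case=> /= h1 h2; move: h1; rewrite zf; case: (f); lra.
    exists (z.1, z.2 + (if f then d / 2 else - (d / 2))).
      by apply: dU; rewrite ?subrr // addrAC subrr add0r.
    by case=> /= h1 h2; move: h2; rewrite zf; case: (f); lra.
have e2 : 0 < e / 2 by lra.
case: v yS => -[yf yb].
  have [t t1 t2] := close_interior_point hy0 e2 yb.
  by exists (y.1, t); split=> //=; rewrite subrr normr0.
have [t t1 t2] := close_interior_point hx0 e2 yb.
by exists (t, y.2); split=> //=; rewrite subrr normr0.
Qed.

End Sides.

(** * Conformity: the two neighbours of an interior edge *)

Section UniformMesh.
Context {R : realType} {nT ne : nat}.
Variables (Omega : set (R * R)) (F : 'I_nT -> affine_map R).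
Variables (p : 'I_ne -> bool -> R * R) (hx hy : R) (c : 'I_nT -> R * R).
Hypothesis F_mesh : conforming_mesh F Omega.
Hypotheses (hx0 : 0 < hx) (hy0 : 0 < hy).
Hypothesis F_rect : forall k, element F k = rectangle (c k) hx hy.
Hypothesis p_enum : interior_edge_enum F p Omega.
Implicit Types (v f l : bool) (k : 'I_nT) (i : 'I_ne) (z : R * R).

Lemma mesh_frame k : exists s m1 m2,
  affine_app (F k) = frame (c k) hx hy s m1 m2.
Proof. exact: frame_exists (F_rect k). Qed.

Lemma element_edgeP k e :
  element_edge F k e <-> exists v f, e = side (c k) hx hy v f.
Proof.
have [s [m1 [m2 E]]] := mesh_frame k.
split=> [[al ->]|[v [f ->]]].
  by rewrite E frame_edge; exists (frame_vert s al), (frame_far s m1 m2 al).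
have [al [<- <-]] := frame_side_surj s m1 m2 v f.
by exists al; rewrite E frame_edge.
Qed.

Lemma element_vertex_corner k z :
  element_vertex F k z -> corner (c k) hx hy z.
Proof.
have [s [m1 [m2 E]]] := mesh_frame k.
by move=> [r ->]; rewrite E; exact: frame_corner.
Qed.

Lemma elements_meet j k z : j != k -> element F j z -> element F k z ->
  corner (c j) hx hy z \/ exists v f v' f',
    side (c j) hx hy v f = side (c k) hx hy v' f' /\ side (c j) hx hy v f z.
Proof.
move=> jk jz kz; have jkz : (element F j `&` element F k) z by split.
have [_ _ /(_ j k jk) [E|[w [wj _ E]]|[e [ej ek E]]]] := F_mesh.
- by rewrite E in jkz.
- by left; rewrite E in jkz; rewrite jkz; exact: element_vertex_corner.
- right; rewrite E in jkz.
  have [v [f E1]] := (element_edgeP j e).1 ej.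
  have [v' [f' E2]] := (element_edgeP k e).1 ek.
  by exists v, f, v', f'; rewrite -E1 -E2.
Qed.

Lemma interiors_disjoint j k : j != k ->
  interior (element F j) `&` interior (element F k) = set0.
Proof.
move=> jk; rewrite -subset0 => z [jz kz]; exfalso.
have := elements_meet jk (interior_subset jz) (interior_subset kz).
move: jz; rewrite F_rect interior_rectangle /= !in_itv /= => -[jz1 jz2].
case=> [|[v [f [_ [_ [_ /(sideP _ _ _ _ hx0 hy0)]]]]]].
  by move=> [[h|h] _]; lra.
by case: v; case: f; lra.
Qed.

Lemma corner_injective : injective c.
Proof.
move=> j k cjk; apply/eqP; apply: contrapT => /negP jk.
have := interiors_disjoint jk; rewrite !F_rect cjk setIid.
rewrite interior_rectangle => /seteqP [/(_ ((c k).1 + hx / 2, (c k).2 + hy / 2))].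
have := hx0; have := hy0 => ? ? H _.
by apply: H; split; rewrite /= in_itv /=; lra.
Qed.

Lemma side_injective j k v v' f f' :
  side (c j) hx hy v f = side (c k) hx hy v' f' ->
  v = v' /\ (f = f' <-> j = k).
Proof.
move=> /(side_inj hx0 hy0) [-> [h1 h2]]; split=> //; split=> [/h1|jk].
  exact: corner_injective.
by apply: h2; rewrite jk.
Qed.

(** There are finitely many elements and each is closed, so those missing [z] also miss a
    neighbourhood of [z]. *)
Lemma nbhs_mesh z : \forall w \near z, forall k, element F k w -> element F k z.
Proof.
apply: (filter_forall (f := fun k w => element F k w -> element F k z)
  (F := nbhs z)) => k.
have [kz|kz] := pselect (element F k z).
  exact: nearW.
rewrite F_rect in kz *; apply: filterS (near_not_rectangle kz) => w kw.
by move=> /kw.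
Qed.

(* Beyond an interior edge of an element lies another element, which conformity
   forces to share the whole edge. *)
Lemma opposite_element k v f : interior_edge F Omega (side (c k) hx hy v f) ->
  exists k', side (c k) hx hy v f = side (c k') hx hy v (~~ f).
Proof.
have [_ cover _] := F_mesh.
move=> [_ /existsNP [y /not_implyP [ky nby]]].
(* [y] lies in an element, hence in the closure of [Omega]; not being a boundary point, it is
   interior. *)
have nO : nbhs y Omega.
  apply: contrapT => nO; apply: nby; split=> //; rewrite cover; exists k => //.
  move: ky => /(sideP _ _ _ _ hx0 hy0); rewrite F_rect /rectangle /=.
  by have := hx0; have := hy0; case: v; case: f; lra.
have [z [nz kz cz sz out]] := side_relative_interior hx0 hy0 ky nO.
(* [w] is in [Omega] and outside element [k], yet so close to [z] that every element containing [w]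
   contains [z]. *)
have [w [Ow wz] kw] := out _ (filterI nz (nbhs_mesh z)).
have : closure Omega w by exact: subset_closure.
rewrite cover => -[k' _ k'w].
have kk' : k != k'.
  by apply/eqP => kk'; apply: kw; rewrite kk' -F_rect.
(* As [z] is no corner, the elements share a side through [z], and only the given side passes there.
   Were it the same side of both, they would coincide. *)
have := elements_meet kk' _ (wz _ k'w); rewrite F_rect => /(_ kz) [//|].
move=> [v1 [f1 [v2 [f2 [E /sz [e1 e2]]]]]]; rewrite e1 e2 in E.
exists k'; have [e3 [e4 _]] := side_injective E.
have ff2 : f != f2 by apply/eqP => /e4 e; rewrite e eqxx in kk'.
have -> : ~~ f = f2 by case: (f) (f2) ff2 => -[].
by rewrite [in RHS]e3.
Qed.

Lemma p_ordered i : ordered (p i false) (p i true).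
Proof.
have [_ _ /(_ i)] := p_enum.
by rewrite /positively_oriented /ordered; case; lra.
Qed.

Definition vertical i : bool := ~~ horizontal p i.

(** Edges and sides both run in the positive coordinate direction, so their start and end points
    agree too. *)
Lemma edge_side_inj i k v f : edge p i = side (c k) hx hy v f ->
  v = vertical i /\
  forall l, p i l = (if l then side_end else side_start) (c k) hx hy v f.
Proof.
move=> /(ordered_eq_side hx0 hy0 (p_ordered i)) [e0 e1]; split; last by case.
rewrite /vertical /horizontal e0 e1 /side_end /=.
case: v {e0 e1} => /=; last by rewrite addr0 eqxx.
by rewrite -subr_eq0 opprD addrA subrr sub0r oppr_eq0 gt_eqF.
Qed.

Lemma edge_interior i : interior_edge F Omega (edge p i).
Proof. by have [_ <- _] := p_enum; exists i. Qed.

(** The edge is the bottom or left side of [k0] and the top or right side of [k1]; by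
    [side_injective] no third element has it. *)
Lemma edge_elements i : exists k0 k1, k0 != k1 /\
  forall k v f, edge p i = side (c k) hx hy v f <->
    v = vertical i /\ k = if f then k1 else k0.
Proof.
have [k [f E]] : exists k f, edge p i = side (c k) hx hy (vertical i) f.
  have [[k /element_edgeP [v [f E]]] _] := edge_interior i.
  by exists k, f; have [<- _] := edge_side_inj E.
have [k' E'] : exists k', edge p i = side (c k') hx hy (vertical i) (~~ f).
  rewrite E; apply: opposite_element; rewrite -E; exact: edge_interior.
exists (if f then k' else k), (if f then k else k').
have kk' : k != k'.
  apply/eqP => kk'; have [_ [_ /(_ kk')]] := side_injective (etrans (esym E) E').
  by case: f {E E'}.
split; first by case: f {E E'} => //; rewrite eq_sym.
move=> j v g; split=> [Ej|[-> ->]]; last first.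
  by move: E E'; case: f; case: g.
have [ev _] := edge_side_inj Ej; split=> //; rewrite ev in Ej.
have [_ [h1 _]] := side_injective (etrans (esym Ej) E).
have [_ [h2 _]] := side_injective (etrans (esym Ej) E').
by move: h1 h2; case: g {Ej}; case: f {E E'} => /= h1 h2;
  (exact: h1 || exact: h2).
Qed.

End UniformMesh.

(** * A global basis function on one of its elements *)

Section EdgeBasis.
Context {R : realType} {nT ne : nat}.
Variables (F : 'I_nT -> affine_map R) (p : 'I_ne -> bool -> R * R).
Variables (c : R * R) (hx hy : R) (k : 'I_nT) (i : 'I_ne) (s m1 m2 v f : bool).
Hypotheses (hx0 : 0 < hx) (hy0 : 0 < hy).
Hypothesis F_unit : linpart (F k) \in unitmx.
Hypothesis F_frame : affine_app (F k) = frame c hx hy s m1 m2.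
Hypothesis i_side : edge p i = side c hx hy v f.
Hypothesis p_side : forall l : bool,
  p i l = (if l then side_end else side_start) c hx hy v f.
Implicit Types (al r : 'I_4) (l ga : bool).

Lemma side_start_neq_end : side_start c hx hy v f != side_end c hx hy v f.
Proof.
apply/eqP => /(congr1 (fun z => z.1 + z.2)); rewrite /side_end /=.
by have := hx0; have := hy0; case: v; lra.
Qed.

Lemma p_side_inj l ga : p i l = p i ga -> l = ga.
Proof.
rewrite !p_side => E; have := side_start_neq_end.
by case: l ga E => -[] // ->; rewrite eqxx.
Qed.

Definition on_edge al := frame_vert s al = v /\ frame_far s m1 m2 al = f.

Lemma on_edgeP al : affine_app (F k) @` ref_edge al = edge p i <-> on_edge al.
Proof.
rewrite F_frame frame_edge i_side; split=> [|[-> ->] //].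
by move=> /(side_inj hx0 hy0) [e1 [_ /(_ erefl) e2]].
Qed.

Lemma p_endpoint al l : on_edge al ->
  p i l = affine_app (F k) (ref_endpoint al (l (+) frame_rev s m1 m2 al)).
Proof. by move=> [e1 e2]; rewrite F_frame frame_endpoint e1 e2 addbK p_side. Qed.

(** The side fixes the reference edge and the endpoint fixes [ga], so the search has one answer. Its
    sign depends only on whether the frame reverses the edge, hence is common to both endpoints. *)
Lemma edge_basisE : exists2 al, on_edge al & forall l x,
  edge_basis F p i l k x = sg (frame_rev s m1 m2 al) *:
    ((invmx (linpart (F k)))^T *m
     ref_basis al (l (+) frame_rev s m1 m2 al) (affine_inv (F k) x)).
Proof.
have [al [e1 e2]] := frame_side_surj s m1 m2 v f.
have al_edge : on_edge al by [].
exists al => // l x; rewrite /edge_basis; case: pickP => [[be ga]|/(_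
    (al, l (+) frame_rev s m1 m2 al))]; last first.
  by move=> /asboolP []; rewrite -(p_endpoint l al_edge) on_edgeP.
move=> /asboolP [/= /on_edgeP [e3 e4] E].
have eb : be = al.
  by apply: (@frame_side_inj s m1 m2); rewrite ?e1 ?e2.
subst be; have eg : ga = l (+) frame_rev s m1 m2 al.
  apply: (@addIb (frame_rev s m1 m2 al)); rewrite addbK; apply: p_side_inj.
  by rewrite -E (p_endpoint _ al_edge) addbK.
rewrite eg; congr (_ *: _).
by case: l {E eg}; case: frame_rev.
Qed.

(** The sign of the basis function cancels the one in [frame_dual], so the nodal value no longer
    depends on the frame. *)
Lemma edge_basis_vertex : exists2 w : bool -> 'I_4, injective w &
  forall l, p i l = affine_app (F k) (ref_vertex (w l)) /\
    forall r, edge_basis F p i l k (affine_app (F k) (ref_vertex r)) =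
      (r == w l)%:R *: side_dual hx hy v.
Proof.
have [al al_edge E] := edge_basisE.
pose w l := ref_endpoint_index al (l (+) frame_rev s m1 m2 al).
have pw l : p i l = affine_app (F k) (ref_vertex (w l)).
  by rewrite (p_endpoint l al_edge) ref_endpoint_vertex.
exists w => [l ga E'|l]; first by apply: p_side_inj; rewrite !pw E'.
split=> // r; rewrite E affine_invK // ref_basis_vertex -scalemxAr.
rewrite scalerA mulrC -scalerA; congr (_ *: _).
rewrite scalemxAr -(frame_dual _ _ _ F_frame) ?gt_eqF //.
by rewrite trmx_inv mulKmx ?unitmx_tr //; case: al_edge => ->.
Qed.

(** The orientation [s (+) m1 (+) m2] enters through the determinant and through [frame_rev] and
    cancels; what remains is positive exactly on bottom and right sides. *)
Lemma curl_phi x : curl_h (phi F p i) k x = sg (v (+) f) / (hx * hy).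
Proof.
have [al [e1 e2] E] := edge_basisE.
rewrite /curl_h (_ : phi F p i k = fun y => sg (frame_rev s m1 m2 al) *:
    ((invmx (linpart (F k)))^T *m (ref_basis al false (affine_inv (F k) y) +
                                  ref_basis al true (affine_inv (F k) y)))).
  rewrite curl_ref_basis det_inv (frame_det F_frame) /frame_rev e1 e2.
  rewrite -addbA; set b := s (+) m1 (+) m2.
  have hxy : hx * hy != 0 by rewrite mulf_neq0 // gt_eqF.
  by rewrite /sg; case: b; case: (v (+) f) => /=; field; rewrite !gt_eqF.
apply/funext => y.
rewrite /phi /phi_tilde -[lshift ne i]/(unsplit (inl i)).
rewrite -[rshift ne i]/(unsplit (inr i)) !unsplitK !E -scalerDr -mulmxDr.
by case: frame_rev => //=; rewrite addrC.
Qed.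

End EdgeBasis.

Lemma edge_basis0 (R : realType) nT ne (F : 'I_nT -> affine_map R)
    (p : 'I_ne -> bool -> R * R) i l k x :
  ~ element_edge F k (edge p i) -> edge_basis F p i l k x = 0.
Proof.
move=> ik; rewrite /edge_basis; case: pickP => // -[al ga] /asboolP [/= E _].
by exfalso; apply: ik; exists al.
Qed.

Lemma invmx_diag (R : fieldType) n (d : 'rV[R]_n) :
  (forall j, d 0 j != 0) ->
  diag_mx d \in unitmx /\ invmx (diag_mx d) = diag_mx (map_mx GRing.inv d).
Proof.
move=> d0.
have dV : diag_mx d *m diag_mx (map_mx GRing.inv d) = 1%:M.
  rewrite mulmx_diag -diag_const_mx; congr diag_mx; apply/rowP => j.
  by rewrite !mxE divff.
have [ud _] := mulmx1_unit dV; split=> //.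
by rewrite -[RHS](mulKmx ud) dV mulmx1.
Qed.

Lemma Pmx_block (R : realType) ne :
  Pmx (ne := ne) = row_mx (2^-1%:M) (2^-1%:M) :> 'M[R]_(ne, ne + ne).
Proof.
apply/matrixP => i j; rewrite -(splitK j) [LHS]mxE; case: (fintype.split j) => j' /=.
  rewrite row_mxEl !mxE [(j' == _ + _ :> nat)%N]ltn_eqF ?orbF; last first.
    by rewrite (leq_trans (ltn_ord j')) // leq_addl.
  by rewrite eq_sym val_eqE; case: eqP.
rewrite row_mxEr !mxE gtn_eqF /=; last by rewrite (leq_trans (ltn_ord i)) ?leq_addr.
by rewrite addnC eqn_add2r eq_sym val_eqE; case: eqP.
Qed.

(** * The three matrices and their Yee counterparts *)

Section Matrices.
Context {R : realType} {nT ne : nat}.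
Variables (Omega : set (R * R)) (F : 'I_nT -> affine_map R).
Variables (p : 'I_ne -> bool -> R * R) (hx hy : R) (c : 'I_nT -> R * R).
Hypothesis Omega_polygonal : polygonal_domain Omega.
Hypothesis F_mesh : conforming_mesh F Omega.
Hypotheses (hx0 : 0 < hx) (hy0 : 0 < hy).
Hypothesis F_rect : forall k, element F k = rectangle (c k) hx hy.
Hypothesis p_enum : interior_edge_enum F p Omega.
Implicit Types (v f l m : bool) (k : 'I_nT) (i j : 'I_ne).

Let F_unit k : linpart (F k) \in unitmx.
Proof. by case: F_mesh. Qed.

Let dual i : 'cV[R]_2 := side_dual hx hy (vertical p i).

Lemma local_basis i k v f : edge p i = side (c k) hx hy v f ->
  exists2 w : bool -> 'I_4, injective w &
  forall l, p i l = affine_app (F k) (ref_vertex (w l)) /\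
    forall r, edge_basis F p i l k (affine_app (F k) (ref_vertex r)) =
      (r == w l)%:R *: dual i.
Proof.
move=> E; have [s [m1 [m2 Fk]]] := mesh_frame hx0 hy0 F_rect k.
have [ev ps] := edge_side_inj hx0 hy0 p_enum E; rewrite ev in E ps *.
exact: (edge_basis_vertex hx0 hy0 (F_unit k) Fk E ps).
Qed.

Lemma dotZZ (a b : R) (u w : 'cV[R]_2) : dot (a *: u) (b *: w) = a * b * dot u w.
Proof. by rewrite /dot !sum_ord2 !mxE; ring. Qed.

Lemma dot0l (w : 'cV[R]_2) : dot 0 w = 0.
Proof. by rewrite /dot !sum_ord2 !mxE; ring. Qed.

Lemma dot0r (w : 'cV[R]_2) : dot w 0 = 0.
Proof. by rewrite /dot !sum_ord2 !mxE; ring. Qed.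

(** Two elements contribute, each at one vertex with weight [hx * hy / 4]. *)
Definition lumped_mass eps i : R := eps * (hx * hy / 2) * dot (dual i) (dual i).

Lemma local_mass_same eps i l k v f : edge p i = side (c k) hx hy v f ->
  \sum_(r < 4) dot (eps *: edge_basis F p i l k (affine_app (F k) (ref_vertex r)))
    (edge_basis F p i l k (affine_app (F k) (ref_vertex r)))
  = eps * dot (dual i) (dual i).
Proof.
move=> /local_basis [w _ /(_ l) [_ E]].
rewrite (bigD1 (w l)) //= big1 => [|r /negPf rw]; rewrite !E.
  by rewrite eqxx !scale1r -[X in dot _ X]scale1r dotZZ mulr1 addr0.
by rewrite rw !scale0r dot0r.
Qed.

(* Distinct basis functions never meet at a vertex of an element, except for two
   perpendicular sides, where their values are orthogonal. *)
Lemma local_mass_distinct eps i j l m k : (i, l) != (j, m) ->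
  \sum_(r < 4) dot (eps *: edge_basis F p j m k (affine_app (F k) (ref_vertex r)))
    (edge_basis F p i l k (affine_app (F k) (ref_vertex r))) = 0.
Proof.
move=> ne_ij; apply: big1 => r _.
have [ik|ik] := pselect (element_edge F k (edge p i)); last first.
  by rewrite (edge_basis0 _ _ ik) dot0r.
have [jk|jk] := pselect (element_edge F k (edge p j)); last first.
  by rewrite (edge_basis0 _ _ jk) scaler0 dot0l.
have [v [f Ei]] := (element_edgeP hx0 hy0 F_rect k _).1 ik.
have [v' [f' Ej]] := (element_edgeP hx0 hy0 F_rect k _).1 jk.
have [evi pi] := edge_side_inj hx0 hy0 p_enum Ei.
have [evj pj] := edge_side_inj hx0 hy0 p_enum Ej.
have [wi wi_inj /(_ l) [pwi ->]] := local_basis Ei.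
have [wj _ /(_ m) [pwj ->]] := local_basis Ej.
rewrite scalerA dotZZ.
have [rj|] := eqVneq r (wj m); last by rewrite mulr0 !mul0r.
have [ri|] := eqVneq r (wi l); last by rewrite mulr0 !mul0r.
have [vv|vv] := eqVneq v v'; last first.
  rewrite /dual -evi -evj /side_dual /dot !sum_ord2 !mxE /=.
  by case: v v' vv {Ei Ej evi evj pi pj} => -[] //=; rewrite !(mulr0, mul0r, addr0).
(* Parallel sides of one element through a common vertex coincide, so both the edges and the
   endpoints would be equal. *)
have pp : p i l = p j m by rewrite pwi pwj -ri -rj.
have ff : f = f'.
  by move: pp; rewrite pi pj vv => /(side_endpoint_far hx0 hy0).
have ij : i = j by have [inj _ _] := p_enum; apply: inj; rewrite Ei Ej vv ff.
subst j; case/eqP: ne_ij; congr pair.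
by apply: (p_side_inj hx0 hy0 pi); exact: pp.
Qed.

Lemma inner_h_basis eps i j l m :
  inner_h F (fun k x => eps *: edge_basis F p j m k x) (edge_basis F p i l) =
  if (i, l) == (j, m) then lumped_mass eps i else 0.
Proof.
have area_k k : area (element F k) = hx * hy by rewrite F_rect area_rectangle.
rewrite /inner_h; case: eqVneq => [[<- <-]|ne_ij]; last first.
  by apply: big1 => k _; rewrite local_mass_distinct // mulr0.
have [k0 [k1 [k01 K]]] := edge_elements F_mesh hx0 hy0 F_rect p_enum i.
rewrite (bigD1 k0) //= (bigD1 k1) /=; last by rewrite eq_sym.
have E0 := (K k0 _ false).2 (conj erefl erefl).
have E1 := (K k1 _ true).2 (conj erefl erefl).
set q := eps * dot (dual i) (dual i).
transitivity (hx * hy / 4 * q + (hx * hy / 4 * q + 0)); last first.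
  by rewrite /lumped_mass /q; field.
congr (_ + (_ + _)).
- by congr (_ * _); [rewrite area_k | exact: (local_mass_same eps l E0)].
- by congr (_ * _); [rewrite area_k | exact: (local_mass_same eps l E1)].
apply: big1 => k /andP [kk0 kk1]; rewrite big1 ?mulr0 // => r _.
rewrite edge_basis0 ?dot0r //.
move=> /(element_edgeP hx0 hy0 F_rect) [v [f /K [_ ek]]].
by move: kk0 kk1; rewrite ek; case: (f); rewrite eqxx.
Qed.

Lemma Meps_tilde_diag eps : Meps_tilde F p eps =
  diag_mx (row_mx (\row_i lumped_mass eps i) (\row_i lumped_mass eps i)).
Proof.
rewrite diag_mx_row; apply/matrixP => i j; rewrite mxE.
rewrite -(splitK i) -(splitK j) /phi_tilde !unsplitK.
by case: (fintype.split i) => i'; case: (fintype.split j) => j' /=;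
  rewrite ?block_mxEul ?block_mxEur ?block_mxEdl ?block_mxEdr !mxE inner_h_basis
    xpair_eqE /= ?andbT ?andbF //; case: eqVneq => [->|].
Qed.

Lemma lumped_massE eps i : lumped_mass eps i =
  2^-1 * (if horizontal p i then eps * (hy / hx) else eps * (hx / hy)).
Proof.
rewrite /lumped_mass /dual /side_dual /dot sum_ord2 !mxE /= /vertical.
by case: horizontal => /=; field; rewrite !gt_eqF.
Qed.

(** Invertibility is included because [invmx] returns a singular matrix unchanged; here both
    inverses are genuine. *)
Lemma mass_matrices eps : 0 < eps ->
  [/\ Meps_tilde F p eps \in unitmx, Meps_inv F p eps \in unitmx &
      Meps F p eps = Meps_Yee p hx hy eps].
Proof.
move=> eps0.
pose y : 'rV[R]_ne :=
  \row_i (if horizontal p i then eps * (hy / hx) else eps * (hx / hy)).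
have y0 i : y 0 i != 0.
  by rewrite mxE; case: ifP => _; rewrite gt_eqF // mulr_gt0 // divr_gt0.
have md : \row_i lumped_mass eps i = 2^-1 *: y.
  by apply/rowP => i; rewrite !mxE lumped_massE.
have d0 (j : 'I_(ne + ne)) : (row_mx (2^-1 *: y) (2^-1 *: y)) 0 j != 0.
  by rewrite mxE; case: fintype.split => i; rewrite mxE mulf_neq0 // invr_eq0.
have [uM iM] := invmx_diag d0.
have [uy iy] := invmx_diag y0.
(* Both diagonal blocks are [y / 2], with inverse [2 / y]; the two factors [1 / 2] from [Pmx] and
   the sum over two blocks give [1 / y]. *)
have E : Meps_inv F p eps = invmx (diag_mx y).
  rewrite /Meps_inv Meps_tilde_diag md iM Pmx_block map_row_mx diag_mx_row.
  rewrite mul_row_block tr_row_mx mul_row_col !mulmx0 addr0 add0r.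
  rewrite !tr_scalar_mx !mul_scalar_mx !mul_mx_scalar.
  rewrite iy; apply/matrixP => i j; rewrite !mxE.
  by case: ifP => _; case: eqP => _; rewrite ?mulr1n ?mulr0n; field;
    rewrite ?gt_eqF.
rewrite /Meps E Meps_tilde_diag md; split=> //; first by rewrite unitmx_inv.
by rewrite invmxK.
Qed.

Lemma element_sub_closure k : element F k `<=` closure Omega.
Proof. by have [_ -> _] := F_mesh; move=> z kz; exists k. Qed.

Let inner_psiE (a : broken R) k (val : R) :
  (forall z, interior (element F k) z -> a k z = val) ->
  inner F Omega a (psi k) = val * (hx * hy).
Proof.
apply: (inner_psi hx0 hy0 F_rect _ Omega_polygonal).
  exact: interiors_disjoint F_mesh hx0 hy0 F_rect.
exact: element_sub_closure.
Qed.

Lemma Mmu_uniform mu : Mmu F Omega mu = Mmu_Yee hx hy mu.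
Proof.
apply/matrixP => i j; rewrite !mxE (inner_psiE (val := mu * (i == j)%:R)) //.
by case: eqP => _; rewrite ?mulr1n ?mulr0n; ring.
Qed.

(** Integrating the constant curl over an element cancels the inverse area, so only the sign
    attached to the side remains. *)
Lemma Cmx_uniform : Cmx F p Omega = C_Yee p hx hy c.
Proof.
apply/matrixP => i j; rewrite !mxE.
have ll : side (c i) hx hy false false = segment (c i) ((c i).1 + hx, (c i).2).
  by rewrite /side /side_end /side_start /= !addr0 -surjective_pairing.
have rr : side (c i) hx hy true true =
    segment ((c i).1 + hx, (c i).2) ((c i).1 + hx, (c i).2 + hy).
  by rewrite /side /side_end /side_start /= !addr0.
have tt : side (c i) hx hy false true =
    segment ((c i).1, (c i).2 + hy) ((c i).1 + hx, (c i).2 + hy).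
  by rewrite /side /side_end /side_start /= !addr0.
have le : side (c i) hx hy true false = segment (c i) ((c i).1, (c i).2 + hy).
  by rewrite /side /side_end /side_start /= !addr0 -surjective_pairing.
rewrite /= -ll -rr -tt -le.
have hxy : hx * hy != 0 by rewrite mulf_neq0 // gt_eqF.
(* If the edge is no side of the element, the basis function vanishes there and all four tests in
   [C_Yee] fail. *)
have [ij|ij] := pselect (element_edge F i (edge p j)); last first.
  rewrite (inner_psiE (val := 0)) ?mul0r => [|z _]; last first.
    have phi0 : phi F p j i = fun=> 0.
      apply/funext => x; rewrite /phi /phi_tilde -[lshift ne j]/(unsplit (inl j)).
      rewrite -[rshift ne j]/(unsplit (inr j)) !unsplitK !edge_basis0 //.
      exact: addr0.
    by rewrite /curl_h /curl phi0 !derive1_cst subrr.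
  have nE v f : edge p j <> side (c i) hx hy v f.
    by move=> E; apply: ij; apply/(element_edgeP hx0 hy0 F_rect); exists v, f.
  by do 2! (rewrite asboolF; last by case; exact: nE).
have [v [f E]] := (element_edgeP hx0 hy0 F_rect i _).1 ij.
have [s [m1 [m2 Fi]]] := mesh_frame hx0 hy0 F_rect i.
have [_ pj] := edge_side_inj hx0 hy0 p_enum E.
rewrite (inner_psiE (val := sg (v (+) f) / (hx * hy))) ?divfK // => [|z _]; last first.
  exact: (curl_phi hx0 hy0 Fi E pj).
have inj v' f' : edge p j = side (c i) hx hy v' f' -> v = v' /\ f = f'.
  by rewrite E => /(side_inj hx0 hy0) [-> [_ ->]].
case: asboolP => [[]/inj [-> ->] //|n1].
case: asboolP => [[]/inj [-> ->] //|n2].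
exfalso; case: v f E {inj pj} => -[] E; by [apply: n1; auto | apply: n2; auto].
Qed.

End Matrices.

Theorem lemma7 (R : realType) (Omega : set (R * R)) (nT ne : nat)
  (F : 'I_nT -> affine_map R) (p : 'I_ne -> bool -> R * R)
  (hx hy eps mu : R) (c : 'I_nT -> R * R)
  (hOmega : polygonal_domain Omega)
  (hmesh : conforming_mesh F Omega)
  (hhx : 0 < hx) (hhy : 0 < hy)
  (huniform : forall k, element F k = rectangle (c k) hx hy)
  (hedges : interior_edge_enum F p Omega)
  (heps : 0 < eps) (hmu : 0 < mu) :
  (Meps_tilde F p eps \in unitmx /\ Meps_inv F p eps \in unitmx) /\
  [/\ Meps F p eps = Meps_Yee p hx hy eps,
      Mmu F Omega mu = Mmu_Yee hx hy mu &
      Cmx F p Omega = C_Yee p hx hy c].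
Proof.
have [uMt uMi EM] := mass_matrices hmesh hhx hhy huniform hedges heps.
split=> //; split=> //.
- exact: (Mmu_uniform hOmega hmesh hhx hhy huniform).
- exact: (Cmx_uniform hOmega hmesh hhx hhy huniform hedges).
Qed.
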